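(* Let $\mathcal{X}$ be a finite nonempty set. The noisiness topology $\mathcal{T}_{\mathcal{X},\ast}^{(o)}$, i.e. the metric topology on $\mathrm{DMC}_{\mathcal{X},\ast}^{(o)}$ induced by the noisiness metric $d_{\mathcal{X},\ast}^{(o)}$, is a natural topology.
   Context: For finite nonempty sets $\mathcal{X},\mathcal{Y}$, $\mathrm{DMC}_{\mathcal{X},\mathcal{Y}}$ is the set of channels from $\mathcal{X}$ to $\mathcal{Y}$, i.e. functions $W:\mathcal{X}\times\mathcal{Y}\to[0,1]$, written $W(y|x)$, with $\sum_{y\in\mathcal{Y}}W(y|x)=1$ for every $x\in\mathcal{X}$. It carries the topology inherited from the Euclidean topology of $\mathbb{R}^{\mathcal{X}\times\mathcal{Y}}$. For $W\in\mathrm{DMC}_{\mathcal{X},\mathcal{Y}}$ and $V\in\mathrm{DMC}_{\mathcal{Y},\mathcal{Z}}$, the composition $V\circ W\in\mathrm{DMC}_{\mathcal{X},\mathcal{Z}}$ is $(V\circ W)(z|x)=\sum_{y\in\mathcal{Y}}V(z|y)W(y|x)$. A channel $W'\in\mathrm{DMC}_{\mathcal{X},\mathcal{Z}}$ is degraded from $W\in\mathrm{DMC}_{\mathcal{X},\mathcal{Y}}$ if $W'=V\circ W$ for some $V\in\mathrm{DMC}_{\mathcal{Y},\mathcal{Z}}$; $W$ and $W'$ are equivalent if each is degraded from the other. $\mathrm{DMC}_{\mathcal{X},\mathcal{Y}}^{(o)}$ is the quotient of $\mathrm{DMC}_{\mathcal{X},\mathcal{Y}}$ by this equivalence relation, with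 the quotient topology $\mathcal{T}_{\mathcal{X},\mathcal{Y}}^{(o)}$. Let $[n]=\{1,\dots,n\}$, let $\mathrm{DMC}_{\mathcal{X},\ast}=\coprod_{n\ge1}\mathrm{DMC}_{\mathcal{X},[n]}$, and let $\mathrm{DMC}_{\mathcal{X},\ast}^{(o)}$ be the quotient set of $\mathrm{DMC}_{\mathcal{X},\ast}$ by equivalence of channels. For each $n\geq 1$, $\mathrm{DMC}_{\mathcal{X},[n]}^{(o)}$ is identified with the subset of $\mathrm{DMC}_{\mathcal{X},\ast}^{(o)}$ consisting of the classes containing a channel with output alphabet $[n]$; these subsets increase with $n$ and their union is $\mathrm{DMC}_{\mathcal{X},\ast}^{(o)}$. A topology on $\mathrm{DMC}_{\mathcal{X},\ast}^{(o)}$ is called natural if for every $n\ge1$ the subspace topology it induces on $\mathrm{DMC}_{\mathcal{X},[n]}^{(o)}$ is $\mathcal{T}_{\mathcal{X},[n]}^{(o)}$. For $m\ge1$, let $\Delta_{[m]\times\mathcal{X}}$ be the set of probability distributions on $[m]\times\mathcal{X}$. For $p\in\Delta_{[m]\times\mathcal{X}}$ and $W\in\mathrm{DMC}_{\mathcal{X},\mathcal{Y}}$ let $$P_c(p,W)=\sup_{D\in\mathrm{DMC}_{\mathcal{Y},[m]}}\ \sum_{u\in[m],\,x\in\mathcal{X},\,y\in\mathcal{Y}}p(u,x)W(y|x)D(u|y).$$ $P_c(p,W)$ depends on $W$ only through its equivalence class, so $P_c(p,\hat W)$ is defined for $\hat W\in\mathrm{DMC}_{\mathcal{X},\ast}^{(o)}$.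 It is a known fact (Buscemi) that two channels $W,W'$ with input alphabet $\mathcal{X}$ are equivalent if and only if $P_c(p,W)=P_c(p,W')$ for all $m\ge 1$ and all $p\in\Delta_{[m]\times\mathcal{X}}$. The noisiness metric is $d_{\mathcal{X},\ast}^{(o)}(\hat W_1,\hat W_2)=\sup_{m\ge1,\,p\in\Delta_{[m]\times\mathcal{X}}}|P_c(p,\hat W_1)-P_c(p,\hat W_2)|$; it is a metric on $\mathrm{DMC}_{\mathcal{X},\ast}^{(o)}$. *)

(* Defs.v *)
From HB Require Import structures.
From mathcomp Require Import all_boot all_order all_algebra.
From mathcomp Require Import all_classical all_reals all_analysis.
From mathcomp Require Import generic_quotient.

Set Implicit Arguments.
Unset Strict Implicit.
Unset Printing Implicit Defensive.

Import Order.TTheory GRing.Theory Num.Theory.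
Import numFieldNormedType.Exports.

Local Open Scope classical_set_scope.
Local Open Scope ring_scope.
Local Open Scope quotient_scope.

(* The value at (x, y) is W(y|x). *)
Definition channel_set (R : realType) (X Y : finType) : set {ptws X * Y -> R} :=
  [set W | (forall x y, 0 <= W (x, y) <= 1) /\
           (forall x, \sum_(y : Y) W (x, y) = 1)].

(* [set_type] carries the subspace topology; for a finite index type the
   pointwise topology of [{ptws X * Y -> R}] is the Euclidean one. *)
Definition DMC (R : realType) (X Y : finType) : Type :=
  set_type (@channel_set R X Y).

HB.instance Definition _ (R : realType) (X Y : finType) :=
  Topological.on (DMC R X Y).

(* tr W y x = W(y|x) *)
Definition tr (R : realType) (X Y : finType) (W : DMC R X Y) (y : Y) (x : X) : R :=
  (set_val W : {ptws X * Y -> R}) (x, y).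

Section channels.
Variable R : realType.

Lemma tr_ge0 (X Y : finType) (W : DMC R X Y) y x : 0 <= tr W y x.
Proof. by have [/(_ x y)/andP[]] := set_valP W. Qed.

Lemma tr_le1 (X Y : finType) (W : DMC R X Y) y x : tr W y x <= 1.
Proof. by have [/(_ x y)/andP[]] := set_valP W. Qed.

Lemma tr_sum (X Y : finType) (W : DMC R X Y) x : \sum_y tr W y x = 1.
Proof. by have [_] := set_valP W; exact. Qed.

Lemma DMC_eq (X Y : finType) (W W' : DMC R X Y) :
  (forall y x, tr W y x = tr W' y x) -> W = W'.
Proof.
move=> h; apply: val_inj; apply/funext => -[x y]; exact: h.
Qed.

Lemma stochastic_channel (X Y : finType) (w : Y -> X -> R) :
  (forall y x, 0 <= w y x) -> (forall x, \sum_y w y x = 1) ->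
  channel_set ((fun xy => w xy.2 xy.1) : {ptws X * Y -> R}).
Proof.
move=> w0 w1; split=> [x y|x]//=; rewrite w0/= -(w1 x).
by rewrite (bigD1 y)//= lerDl sumr_ge0.
Qed.

Definition comp_tr (X Y Z : finType) (V : DMC R Y Z) (W : DMC R X Y)
  (z : Z) (x : X) : R := \sum_(y : Y) tr V z y * tr W y x.

Lemma comp_tr_channel (X Y Z : finType) (V : DMC R Y Z) (W : DMC R X Y) :
  channel_set ((fun xz => comp_tr V W xz.2 xz.1) : {ptws X * Z -> R}).
Proof.
apply: stochastic_channel => [z x|x].
  by apply: sumr_ge0 => y _; rewrite mulr_ge0 ?tr_ge0.
rewrite /comp_tr exchange_big /= -[RHS](tr_sum W x).
by apply: eq_bigr => y _; rewrite -big_distrl /= tr_sum mul1r.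
Qed.

Definition comp_channel (X Y Z : finType) (V : DMC R Y Z) (W : DMC R X Y)
  : DMC R X Z := SigSub (mem_set (comp_tr_channel V W)).

Lemma tr_comp (X Y Z : finType) (V : DMC R Y Z) (W : DMC R X Y) z x :
  tr (comp_channel V W) z x = \sum_(y : Y) tr V z y * tr W y x.
Proof. by []. Qed.

Lemma id_tr_channel (X : finType) :
  channel_set ((fun xy => (xy.2 == xy.1)%:R) : {ptws X * X -> R}).
Proof.
apply: (@stochastic_channel X X (fun y x => (y == x)%:R)) => [y x|x].
  exact: ler0n.
by rewrite (bigD1 x)//= eqxx big1 ?addr0// => y /negbTE ->.
Qed.

Definition id_channel (X : finType) : DMC R X X :=
  SigSub (mem_set (id_tr_channel X)).

Lemma comp_id (X Y : finType) (W : DMC R X Y) : comp_channel (id_channel Y) W = W.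
Proof.
apply: DMC_eq => y x; rewrite tr_comp (bigD1 y)//= [tr (id_channel _) _ _]/tr/=.
rewrite set_valE /= eqxx mul1r big1 ?addr0// => y' y'y.
by rewrite [tr (id_channel _) _ _]/tr set_valE /= eq_sym (negbTE y'y) mul0r.
Qed.

Lemma comp_channelA (X Y Z T : finType) (U : DMC R Z T) (V : DMC R Y Z)
  (W : DMC R X Y) :
  comp_channel U (comp_channel V W) = comp_channel (comp_channel U V) W.
Proof.
apply: DMC_eq => t x; rewrite !tr_comp.
under eq_bigr do rewrite tr_comp mulr_sumr.
rewrite exchange_big; apply: eq_bigr => y _ /=.
by rewrite tr_comp mulr_suml; apply: eq_bigr => z _; rewrite mulrA.
Qed.

Definition degraded (X Y Z : finType) (W' : DMC R X Z) (W : DMC R X Y) : Prop :=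
  exists V : DMC R Y Z, W' = comp_channel V W.

Definition equivalent (X Y Z : finType) (W : DMC R X Y) (W' : DMC R X Z) : Prop :=
  degraded W W' /\ degraded W' W.

Lemma degraded_refl (X Y : finType) (W : DMC R X Y) : degraded W W.
Proof. by exists (id_channel Y); rewrite comp_id. Qed.

Lemma degraded_trans (X Y Z T : finType) (W1 : DMC R X Y) (W2 : DMC R X Z)
  (W3 : DMC R X T) : degraded W1 W2 -> degraded W2 W3 -> degraded W1 W3.
Proof.
move=> [V ->] [V' ->]; exists (comp_channel V V'); exact: comp_channelA.
Qed.

Lemma equivalent_refl (X Y : finType) (W : DMC R X Y) : equivalent W W.
Proof. by split; exact: degraded_refl. Qed.

Lemma equivalent_sym (X Y Z : finType) (W : DMC R X Y) (W' : DMC R X Z) :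
  equivalent W W' -> equivalent W' W.
Proof. by case. Qed.

Lemma equivalent_trans (X Y Z T : finType) (W1 : DMC R X Y) (W2 : DMC R X Z)
  (W3 : DMC R X T) : equivalent W1 W2 -> equivalent W2 W3 -> equivalent W1 W3.
Proof.
by move=> [? ?] [? ?]; split; [exact: (degraded_trans (W2 := W2))|
  exact: (degraded_trans (W2 := W2))].
Qed.

End channels.

Section quotient_DMC.
Variables (R : realType) (X Y : finType).

Definition equivb (W W' : DMC R X Y) : bool := `[< equivalent W W' >].

Lemma equivb_refl : reflexive equivb.
Proof. by move=> W; apply/asboolP; exact: equivalent_refl. Qed.

Lemma equivb_sym : symmetric equivb.
Proof.
by move=> W W'; apply/idP/idP => /asboolP h; apply/asboolP; exact: equivalent_sym.
Qed.

Lemma equivb_trans : transitive equivb.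
Proof.
by move=> W2 W1 W3 /asboolP h1 /asboolP h2; apply/asboolP;
  exact: equivalent_trans h1 h2.
Qed.

Definition equivb_equiv := EquivRel equivb equivb_refl equivb_sym equivb_trans.

Definition DMCo : Type := quotient_topology {eq_quot equivb_equiv}.

HB.instance Definition _ := Topological.on DMCo.
HB.instance Definition _ := Quotient.on DMCo.

End quotient_DMC.

Section quotient_DMC_star.
Variables (R : realType) (X : finType).

(* The alphabet [n], n >= 1, is encoded as 'I_k.+1 with n = k.+1. *)
Definition DMC_star : Type := {k : nat & DMC R X 'I_k.+1}.

HB.instance Definition _ := Choice.on DMC_star.

Definition star_equivb (W W' : DMC_star) : bool :=
  `[< equivalent (projT2 W) (projT2 W') >].

Lemma star_equivb_refl : reflexive star_equivb.
Proof. by move=> W; apply/asboolP; exact: equivalent_refl. Qed.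

Lemma star_equivb_sym : symmetric star_equivb.
Proof.
by move=> W W'; apply/idP/idP => /asboolP h; apply/asboolP; exact: equivalent_sym.
Qed.

Lemma star_equivb_trans : transitive star_equivb.
Proof.
by move=> W2 W1 W3 /asboolP h1 /asboolP h2; apply/asboolP;
  exact: equivalent_trans h1 h2.
Qed.

Definition star_equiv :=
  EquivRel star_equivb star_equivb_refl star_equivb_sym star_equivb_trans.

Definition DMCo_star : Type := {eq_quot star_equiv}.

HB.instance Definition _ := Choice.on DMCo_star.
HB.instance Definition _ := Quotient.on DMCo_star.

Definition star_class (k : nat) (W : DMC R X 'I_k.+1) : DMCo_star :=
  \pi_DMCo_star (existT _ k W).

Lemma star_classP (k l : nat) (W : DMC R X 'I_k.+1) (W' : DMC R X 'I_l.+1) :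
  star_class W = star_class W' <-> equivalent W W'.
Proof. by split=> [/eqmodP/asboolP//|h]; apply/eqmodP/asboolP. Qed.

(* The classes containing a channel with output alphabet [k.+1]. *)
Definition DMCo_sub (k : nat) : set DMCo_star :=
  [set c | exists W : DMC R X 'I_k.+1, star_class W = c].

(* The identification of DMC_{X,[k.+1]}^(o) with [DMCo_sub k]. *)
Definition embed (k : nat) (c : DMCo R X 'I_k.+1) : DMCo_star :=
  star_class (repr c).

Lemma embed_pi (k : nat) (W : DMC R X 'I_k.+1) :
  embed (\pi_(DMCo R X 'I_k.+1) W) = star_class W.
Proof.
apply/star_classP/asboolP.
have /eqmodP// : repr (\pi_(DMCo R X 'I_k.+1) W) =
  W %[mod {eq_quot equivb_equiv R X 'I_k.+1}] by exact: reprK.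
Qed.

Lemma embed_inj (k : nat) : injective (@embed k).
Proof.
move=> c c' /star_classP/asboolP h; rewrite -[c]reprK -[c']reprK.
exact/eqmodP.
Qed.

Lemma range_embed (k : nat) : range (@embed k) = DMCo_sub k.
Proof.
apply/seteqP; split=> [_ [c _ <-]|_ [W <-]]; first by exists (repr c).
by exists (\pi_(DMCo R X 'I_k.+1) W) => //; exact: embed_pi.
Qed.

(* [T] is the family of open sets. *)
Definition is_topology (S : Type) (T : set (set S)) : Prop :=
  [/\ T setT, setI_closed T &
      forall (I : Type) (F : I -> set S), (forall i, T (F i)) -> T (\bigcup_i F i)].

Definition natural_topology (T : set (set DMCo_star)) : Prop :=
  is_topology T /\
  forall (k : nat) (A : set DMCo_star), A `<=` DMCo_sub k ->
    (exists2 U, T U & A = U `&` DMCo_sub k) <-> open (@embed k @^-1` A).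

End quotient_DMC_star.

Definition prob_dist (R : realType) (T : finType) : set (T -> R) :=
  [set p | (forall t, 0 <= p t) /\ \sum_t p t = 1].

Section noisiness.
Variables (R : realType) (X : finType).

(* The success probability of the decoder D. *)
Definition guess (m : nat) (p : 'I_m * X -> R) (Y : finType) (W : DMC R X Y)
  (D : DMC R Y 'I_m) : R :=
  \sum_(u : 'I_m) \sum_(x : X) \sum_(y : Y) p (u, x) * tr W y x * tr D u y.

Definition Pc (m : nat) (p : 'I_m * X -> R) (Y : finType) (W : DMC R X Y) : R :=
  sup [set guess p W D | D in [set: DMC R Y 'I_m]].

(* Independent of the representative for probability distributions p, see
   [Pco_class]. *)
Definition Pco (m : nat) (p : 'I_m * X -> R) (c : DMCo_star R X) : R :=
  Pc p (projT2 (repr c)).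

(* The set is bounded, and is nonempty as soon as X is. *)
Definition noisiness_dist (c1 c2 : DMCo_star R X) : R :=
  sup [set r | exists m (p : 'I_m.+1 * X -> R),
    prob_dist p /\ r = `|Pco p c1 - Pco p c2|].

Lemma guess_comp (m : nat) (p : 'I_m * X -> R) (Y Z : finType)
  (W : DMC R X Y) (V : DMC R Y Z) (D : DMC R Z 'I_m) :
  guess p (comp_channel V W) D = guess p W (comp_channel D V).
Proof.
apply: eq_bigr => u _; apply: eq_bigr => x _.
under eq_bigr do rewrite tr_comp mulr_sumr mulr_suml.
rewrite exchange_big; apply: eq_bigr => y _ /=.
rewrite tr_comp mulr_sumr; apply: eq_bigr => z _.
by rewrite -!mulrA; congr (_ * _); rewrite mulrC -mulrA mulrCA.
Qed.

Lemma guess_ge0 (m : nat) (p : 'I_m * X -> R) (Y : finType) (W : DMC R X Y) D :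
  prob_dist p -> 0 <= guess p W D.
Proof.
move=> [p0 _]; do 3 (apply: sumr_ge0 => ? _).
by rewrite !mulr_ge0 ?tr_ge0.
Qed.

Lemma guess_le1 (m : nat) (p : 'I_m * X -> R) (Y : finType) (W : DMC R X Y) D :
  prob_dist p -> guess p W D <= 1.
Proof.
move=> [p0 p1]; rewrite -p1 /guess (pair_bigA _ (fun u x =>
  \sum_y p (u, x) * tr W y x * tr D u y)) /=.
apply: ler_sum => -[u x] _ /=.
rewrite -[leRHS]mulr1 -(tr_sum W x) mulr_sumr; apply: ler_sum => y _.
by rewrite ler_piMr ?tr_le1// mulr_ge0 ?tr_ge0.
Qed.

Lemma guess_has_sup (m : nat) (p : 'I_m.+1 * X -> R) (Y : finType)
  (W : DMC R X Y) : prob_dist p ->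
  has_sup [set guess p W D | D in [set: DMC R Y 'I_m.+1]].
Proof.
move=> pp; split; last by exists 1 => _ [D _ <-]; exact: guess_le1.
have D0 : channel_set ((fun xy => (xy.2 == ord0)%:R) : {ptws Y * 'I_m.+1 -> R}).
  apply: (@stochastic_channel _ _ _ (fun u y => (u == ord0)%:R)) => [u y|y].
    exact: ler0n.
  by rewrite (bigD1 ord0)//= big1 ?addr0// => u /negbTE ->.
by exists (guess p W (SigSub (mem_set D0))); exists (SigSub (mem_set D0)).
Qed.

Lemma Pc_ge0 (m : nat) (p : 'I_m.+1 * X -> R) (Y : finType) (W : DMC R X Y) :
  prob_dist p -> 0 <= Pc p W.
Proof.
move=> pp; have [[r [D _ rE]] ub] := guess_has_sup W pp.
by apply: (le_trans (guess_ge0 W D pp)); apply: ub_le_sup => //; exists D.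
Qed.

Lemma Pc_le1 (m : nat) (p : 'I_m.+1 * X -> R) (Y : finType) (W : DMC R X Y) :
  prob_dist p -> Pc p W <= 1.
Proof.
move=> pp; have [ne _] := guess_has_sup W pp.
by apply: ge_sup => // _ [D _ <-]; exact: guess_le1.
Qed.

Lemma Pc_degraded (m : nat) (p : 'I_m.+1 * X -> R) (Y Z : finType)
  (W : DMC R X Y) (W' : DMC R X Z) :
  prob_dist p -> degraded W' W -> Pc p W' <= Pc p W.
Proof.
move=> pp [V ->]; apply: ge_sup; first exact: (guess_has_sup _ pp).1.
move=> _ [D _ <-]; rewrite guess_comp; apply: ub_le_sup.
  exact: (guess_has_sup _ pp).2.
by exists (comp_channel D V).
Qed.

Lemma Pc_equivalent (m : nat) (p : 'I_m.+1 * X -> R) (Y Z : finType)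
  (W : DMC R X Y) (W' : DMC R X Z) :
  prob_dist p -> equivalent W W' -> Pc p W = Pc p W'.
Proof.
by move=> pp [h h']; apply/eqP; rewrite eq_le !Pc_degraded.
Qed.

Lemma Pco_class (m : nat) (p : 'I_m.+1 * X -> R) (k : nat)
  (W : DMC R X 'I_k.+1) : prob_dist p -> Pco p (star_class W) = Pc p W.
Proof.
move=> pp; apply: Pc_equivalent => //; apply/star_classP.
rewrite -[RHS]reprK /star_class; congr (\pi_ _ _).
by case: (repr _).
Qed.

Lemma noisiness_dist_ub (m : nat) (p : 'I_m.+1 * X -> R) (c1 c2 : DMCo_star R X) :
  prob_dist p -> `|Pco p c1 - Pco p c2| <= noisiness_dist c1 c2.
Proof.
move=> pp; apply: ub_le_sup; last by exists m, p.
exists 1 => _ [k [q [qq ->]]]; rewrite ler_norml; apply/andP; split.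
  by rewrite lerBrDl; rewrite (le_trans (_ : _ <= 0))// ?Pc_ge0// subr_le0 Pc_le1.
by rewrite lerBlDr (le_trans (Pc_le1 _ qq))// lerDl Pc_ge0.
Qed.

Lemma noisiness_dist_le (c1 c2 : DMCo_star R X) (e : R) : 0 <= e ->
  (forall m (p : 'I_m.+1 * X -> R), prob_dist p ->
     `|Pco p c1 - Pco p c2| <= e) ->
  noisiness_dist c1 c2 <= e.
Proof.
move=> e0 h; rewrite /noisiness_dist; set E := (X in sup X).
have [->|/set0P ne] := eqVneq E set0; first by rewrite sup0.
by apply: ge_sup => // _ [m [p [pp ->]]]; exact: h.
Qed.

Lemma noisiness_dist_ge0 (c1 c2 : DMCo_star R X) : 0 <= noisiness_dist c1 c2.
Proof.
rewrite /noisiness_dist; set E := (X in sup X).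
have [->|/set0P [_ [m [p [pp _]]]]] := eqVneq E set0; first by rewrite sup0.
exact: le_trans (normr_ge0 _) (noisiness_dist_ub c1 c2 pp).
Qed.

Lemma noisiness_distxx (c : DMCo_star R X) : noisiness_dist c c = 0.
Proof.
apply/le_anti; rewrite noisiness_dist_ge0 andbT.
by apply: noisiness_dist_le => // m p _; rewrite subrr normr0.
Qed.

Lemma noisiness_dist_sym (c1 c2 : DMCo_star R X) :
  noisiness_dist c1 c2 = noisiness_dist c2 c1.
Proof.
apply/le_anti/andP; split; apply: noisiness_dist_le;
  rewrite ?noisiness_dist_ge0// => m p pp; rewrite distrC; exact: noisiness_dist_ub.
Qed.

Lemma noisiness_dist_triangle (c2 c1 c3 : DMCo_star R X) :
  noisiness_dist c1 c3 <= noisiness_dist c1 c2 + noisiness_dist c2 c3.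
Proof.
apply: noisiness_dist_le; first by rewrite addr_ge0 ?noisiness_dist_ge0.
move=> m p pp; apply: (le_trans (ler_distD (Pco p c2) _ _)).
by apply: lerD; exact: noisiness_dist_ub.
Qed.

(* [DMCo_star R X] with the metric topology of [noisiness_dist]; separation is
   not needed to define the topology, so the structure is a pseudometric one. *)
Definition noisiness_space : Type := DMCo_star R X.

HB.instance Definition _ := Choice.on noisiness_space.

Definition noisiness_ball (c : noisiness_space) (e : R) : set noisiness_space :=
  [set c' | noisiness_dist c c' < e].

Definition noisiness_ent := entourage_ noisiness_ball.

HB.instance Definition _ := hasNbhs.Build noisiness_space (nbhs_ noisiness_ent).

Lemma noisiness_ball_center (c : noisiness_space) (e : R) :
  0 < e -> noisiness_ball c e c.
Proof. by move=> e0; rewrite /noisiness_ball/= noisiness_distxx. Qed.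

Lemma noisiness_ball_sym (c c' : noisiness_space) (e : R) :
  noisiness_ball c e c' -> noisiness_ball c' e c.
Proof. by rewrite /noisiness_ball/= noisiness_dist_sym. Qed.

Lemma noisiness_ball_triangle (c1 c2 c3 : noisiness_space) (e1 e2 : R) :
  noisiness_ball c1 e1 c2 -> noisiness_ball c2 e2 c3 ->
  noisiness_ball c1 (e1 + e2) c3.
Proof.
move=> h1 h2; apply: (le_lt_trans (noisiness_dist_triangle c2 _ _)).
exact: ltrD.
Qed.

HB.instance Definition _ := @Nbhs_isPseudoMetric.Build R noisiness_space
  noisiness_ent erefl noisiness_ball noisiness_ball_center noisiness_ball_sym
  noisiness_ball_triangle erefl.

End noisiness.

(* The family of open sets of the metric topology. *)
Definition noisiness_topology (R : realType) (X : finType) :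
  set (set (DMCo_star R X)) := [set U | open (U : set (noisiness_space R X))].

Lemma noisiness_topologyP (R : realType) (X : finType) (U : set (DMCo_star R X)) :
  noisiness_topology U <->
  forall c, U c -> exists2 e : R, 0 < e & [set c' | noisiness_dist c c' < e] `<=` U.
Proof.
rewrite /noisiness_topology /= openE; split=> h c Uc.
  by have /nbhs_ballP[e e0 eU] := h c Uc; exists e.
by have [e e0 eU] := h c Uc; apply/nbhs_ballP; exists e.
Qed.

(* Main.v *)
Require Import Defs.
From mathcomp Require Import all_boot all_order all_algebra.
From mathcomp Require Import all_classical all_reals all_analysis.
From mathcomp Require Import generic_quotient ring lra.

(** W |-> d(c, class of W) is Lipschitz for the l^1 distance of channels, so
    noisiness-open sets have open preimages. Conversely, if A is open in the
    quotient and c is in A, this continuous function attains its minimum on the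
    compact set of channels whose class is not in A; the minimum is positive
    because d separates classes, so a ball around c avoids that set.
    Separation is Buscemi's theorem: if W' is not degraded from W, the
    Euclidean projection of W' onto the convex compact set of channels
    degraded from W yields a separating linear functional, which rescales to a
    distribution p with Pc(p, W) < Pc(p, W'). *)

Set Implicit Arguments.
Unset Strict Implicit.
Unset Printing Implicit Defensive.

Import Order.TTheory GRing.Theory Num.Theory.
Import numFieldNormedType.Exports.

Local Open Scope classical_set_scope.
Local Open Scope ring_scope.
Local Open Scope quotient_scope.

(** * Continuity and compactness for spaces of channels *)

Lemma continuous_sum (R : realType) (T : topologicalType) (I : finType)
    (f : I -> T -> R) :
  (forall i, continuous (f i)) -> continuous (fun t => \sum_i f i t).
Proof.
move=> cf t.
by apply: (@cvg_big _ _ _ _ _ add_continuous) => i _; exact: cf.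
Qed.

Section DMC_topology.
Variables (R : realType) (X Y : finType).

Lemma continuous_eval (i : X * Y) :
  continuous (fun W : {ptws X * Y -> R} => W i).
Proof. exact: (@proj_continuous _ (fun=> R) i). Qed.

Lemma continuous_tr (y : Y) (x : X) : continuous (fun W : DMC R X Y => tr W y x).
Proof.
move=> W; apply: (@continuous_comp _ _ _ set_val
  (fun f : {ptws X * Y -> R} => f (x, y))); last exact: continuous_eval.
exact: initial_continuous.
Qed.

(** The cube with factors [[0, 1]] is compact by Tychonoff, and the normalisation conditions cut out
    a closed subset. *)
Lemma compact_channel_set : compact (@channel_set R X Y).
Proof.
pose B := [set W : {ptws X * Y -> R} | forall i, `[0, 1]%classic (W i)].
pose C := \bigcap_(x : X) [set W : {ptws X * Y -> R} | \sum_y W (x, y) = 1].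
have -> : @channel_set R X Y = B `&` C.
  apply/seteqP; split=> W [h1 h2]; split.
  - by move=> [x y] /=; rewrite in_itv /= h1.
  - by move=> x _; exact: h2.
  - by move=> x y; have /= := h1 (x, y); rewrite in_itv.
  - by move=> x; exact: h2.
apply: compact_closedI.
  apply: (@tychonoff _ (fun=> R) (fun=> `[0, 1]%classic)) => i.
  exact: segment_compact.
apply: closed_bigI => x _.
apply: (preimage_closed (f := fun W : {ptws X * Y -> R} => \sum_y W (x, y))
  (D := [set r | r = 1])); last exact: closed_eq.
by move=> W _; apply: continuous_sum => y; exact: continuous_eval.
Qed.

(** A filter on the subtype is pushed forward along [set_val]. The cluster point found in
    [channel_set] lifts back, since the opens of the subtype are preimages of ambient opens. *)
Lemma compact_DMC : compact [set: DMC R X Y].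
Proof.
move=> F FF _.
have GF : ProperFilter (set_val @ F : set_system {ptws X * Y -> R}).
  exact: fmap_proper_filter.
have [|f [ch cl]] := compact_channel_set GF.
  by apply: (@filterS _ F _ setT); [move=> W _; exact: set_valP|exact: filterT].
exists (SigSub (mem_set ch)); split=> // A B FA [_ [[B' oB' <-] Bf BB]].
have [] := cl (set_val @` A) B'.
- by apply: (@filterS _ F _ A) => // W AW; exists W.
- by apply: open_nbhs_nbhs; split=> //; rewrite set_valE in Bf.
by move=> _ [[W AW <-] B'W]; exists W; split=> //; exact: BB.
Qed.

Lemma DMC_min (f : DMC R X Y -> R) (A : set (DMC R X Y)) :
  continuous f -> closed A -> A !=set0 ->
  exists2 W, A W & forall W', A W' -> f W <= f W'.
Proof.
move=> cf clA A0.
have cA : compact A by exact: (subclosed_compact clA compact_DMC).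
have [|W /set_mem AW h] := @compact_EVT_min _ _ f A A0 cA.
  exact: continuous_subspaceT.
by exists W => // W' AW'; apply: h; exact: mem_set.
Qed.

End DMC_topology.

(** * Projection onto the channels degraded from a fixed channel *)

Section degradation.
Variables (R : realType) (X Y Z : finType).

(** The convex combination is written as [V] plus an increment, so that squared distances along the
    segment expand as polynomials in [t]. *)
Lemma mix_channel_set (t : R) (V V' : DMC R Y Z) : 0 <= t <= 1 ->
  channel_set ((fun xy => tr V xy.2 xy.1 + t * (tr V' xy.2 xy.1 - tr V xy.2 xy.1))
    : {ptws Y * Z -> R}).
Proof.
move=> /andP[t0 t1]; apply: (@stochastic_channel R Y Z
  (fun z y => tr V z y + t * (tr V' z y - tr V z y))) => [z y|y].
  by have := tr_ge0 V z y; have := tr_ge0 V' z y; nra.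
by rewrite big_split/= -mulr_sumr sumrB !tr_sum subrr mulr0 addr0.
Qed.

Definition mix (t : R) (V V' : DMC R Y Z) (t01 : 0 <= t <= 1) : DMC R Y Z :=
  SigSub (mem_set (mix_channel_set V V' t01)).

Lemma tr_comp_mix (t : R) (V V' : DMC R Y Z) (t01 : 0 <= t <= 1)
    (W : DMC R X Y) z x :
  tr (comp_channel (mix V V' t01) W) z x = tr (comp_channel V W) z x +
    t * (tr (comp_channel V' W) z x - tr (comp_channel V W) z x).
Proof.
rewrite !tr_comp -sumrB mulr_sumr -big_split /=; apply: eq_bigr => y _.
have -> : tr (mix V V' t01) z y = tr V z y + t * (tr V' z y - tr V z y) by [].
by ring.
Qed.

Lemma continuous_tr_comp (W : DMC R X Y) z x :
  continuous (fun V : DMC R Y Z => tr (comp_channel V W) z x).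
Proof.
apply: continuous_sum => y V; exact: (cvgMr_tmp (@continuous_tr R Y Z z y V)).
Qed.

(** Variational inequality of the Euclidean projection of [W'], attained at [V0] by compactness. The
    given [V] makes the set of candidates nonempty. *)
Lemma degraded_projection (W : DMC R X Y) (W' : DMC R X Z) (V : DMC R Y Z) :
  exists V0 : DMC R Y Z,
  forall V1, \sum_z \sum_x
    (tr W' z x - tr (comp_channel V0 W) z x) *
    (tr (comp_channel V1 W) z x - tr (comp_channel V0 W) z x) <= 0.
Proof.
pose f (V : DMC R Y Z) := \sum_z \sum_x (tr W' z x - tr (comp_channel V W) z x) ^+ 2.
have cf : continuous f.
  apply: continuous_sum => z; apply: continuous_sum => x U.
  apply: (@continuous_comp _ _ _
    (fun V : DMC R Y Z => tr W' z x - tr (comp_channel V W) z x)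
    (fun r : R => r ^+ 2)); last exact: exprn_continuous.
  exact: (cvgB (cvg_cst (tr W' z x)) (@continuous_tr_comp W z x U)).
have [|V0 _ fmin] := DMC_min cf closedT; first by exists V.
exists V0 => V1; set a := \sum_z _.
pose b := \sum_z \sum_x
  (tr (comp_channel V1 W) z x - tr (comp_channel V0 W) z x) ^+ 2.
have b0 : 0 <= b by do 2 (apply: sumr_ge0 => ? _); exact: sqr_ge0.
(* Minimality of [V0] tested along the segment from [V0] to [V1]. *)
have key t : 0 <= t <= 1 -> 2 * t * a <= t ^+ 2 * b.
  move=> t01; rewrite -subr_ge0.
  have <- : f (mix V0 V1 t01) - f V0 = t ^+ 2 * b - 2 * t * a; last first.
    by rewrite subr_ge0 fmin.
  rewrite /f /a /b !mulr_sumr -!sumrB; apply: eq_bigr => z _.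
  rewrite !mulr_sumr -!sumrB; apply: eq_bigr => x _.
  by rewrite tr_comp_mix; ring.
rewrite leNgt; apply/negP => a0.
(* With [t = a / (a + b)], [key] yields [2 * a <= t * b = a - t * a], impossible for [a > 0]; this
   [t] stays in the unit interval even when [b = 0]. *)
have /key : 0 <= a / (a + b) <= 1.
  by rewrite divr_ge0 ?ler_pdivrMr ?mul1r ?lerDl ?ltr_wpDr// ltW// ltr_wpDr.
have ab : 0 < a + b by rewrite ltr_wpDr.
set t := a / _; have t0 : 0 < t by rewrite divr_gt0.
have : t * (a + b) = a by rewrite /t divfK ?gt_eqF.
nra.
Qed.

End degradation.

(** * Buscemi's separation of channels by guessing probabilities *)

Section blackwell.
Variables (R : realType) (X : finType).

Lemma const_channel_set (Y Z : finType) (z0 : Z) :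
  channel_set ((fun yz => (yz.2 == z0)%:R) : {ptws Y * Z -> R}).
Proof.
apply: (@stochastic_channel R Y Z (fun z y => (z == z0)%:R)) => [z y|y].
  exact: ler0n.
by rewrite (bigD1 z0)//= eqxx big1 ?addr0// => z /negbTE ->.
Qed.

Definition const_channel (Y Z : finType) (z0 : Z) : DMC R Y Z :=
  SigSub (mem_set (const_channel_set Y z0)).

Lemma guess_pair (m : nat) (p : 'I_m * X -> R) (Y : finType) (W : DMC R X Y) D :
  guess p W D = \sum_u \sum_x p (u, x) * tr (comp_channel D W) u x.
Proof.
apply: eq_bigr => u _; apply: eq_bigr => x _; rewrite tr_comp mulr_sumr.
by apply: eq_bigr => y _; rewrite -mulrA [tr W y x * _]mulrC.
Qed.

(** The residual [q] of the projection is the separating functional, with the output alphabet of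
    [W'] serving as message alphabet. *)
Lemma not_degraded_Pc (hX : (0 < #|X|)%N) (Y : finType) (m : nat)
    (W : DMC R X Y) (W' : DMC R X 'I_m.+1) : ~ degraded W' W ->
  exists2 p : 'I_m.+1 * X -> R, prob_dist p & Pc p W < Pc p W'.
Proof.
move=> ndeg.
have [V0 hV0] := degraded_projection W W' (const_channel Y ord0).
pose q u x := tr W' u x - tr (comp_channel V0 W) u x.
pose N : R := #|X|%:R * m.+1%:R.
have N0 : 0 < N by rewrite mulr_gt0 ?ltr0n.
(* q sums to 0 over u for each x, so adding 1 makes it a nonnegative
   function of total mass N without changing comparisons of channels. *)
pose p (i : 'I_m.+1 * X) := (q i.1 i.2 + 1) / N.
have q0 x : \sum_u q u x = 0 by rewrite sumrB !tr_sum subrr.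
have pp : prob_dist p.
  split=> [[u x]|].
    rewrite divr_ge0 ?(ltW N0)//= /q; have := tr_ge0 W' u x.
    by have := tr_le1 (comp_channel V0 W) u x; lra.
  rewrite -(pair_bigA _ (fun u x => p (u, x))) /= exchange_big /=.
  under eq_bigr do rewrite -mulr_suml big_split/= q0 add0r sumr_const card_ord.
  by rewrite sumr_const -mulr_natl mulrA divff ?gt_eqF.
(* The added constant 1 pairs to [#|X|] with every channel, so guessing probabilities are compared
   through [q] alone. *)
have gE (U : finType) (W1 : DMC R X U) D : guess p W1 D =
    (\sum_u \sum_x q u x * tr (comp_channel D W1) u x + #|X|%:R) / N.
  rewrite guess_pair; under eq_bigr do under eq_bigr do rewrite mulrAC mulrDl mul1r.
  under eq_bigr do rewrite -mulr_suml.
  rewrite -mulr_suml; congr (_ / _).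
  under eq_bigr do rewrite big_split.
  rewrite big_split; congr (_ + _); rewrite exchange_big /=.
  under eq_bigr do rewrite tr_sum.
  by rewrite sumr_const.
exists p => //.
have sq : 0 < \sum_u \sum_x q u x ^+ 2.
  rewrite lt_neqAle; apply/andP; split; last first.
    by do 2 (apply: sumr_ge0 => ? _); exact: sqr_ge0.
  apply/eqP => /esym/psumr_eq0P h; apply: ndeg; exists V0; apply: DMC_eq => u x.
  have /psumr_eq0P hu : \sum_x q u x ^+ 2 = 0.
    by apply: h => // v _; apply: sumr_ge0 => ? _; exact: sqr_ge0.
  have /eqP : q u x ^+ 2 = 0 by apply: hu => // ? _; exact: sqr_ge0.
  by rewrite sqrf_eq0 subr_eq0 => /eqP.
(* By the projection inequality, [V0] is an optimal decoder for [W]. *)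
apply: (@le_lt_trans _ _ (guess p W V0)).
  apply: ge_sup; first exact: (guess_has_sup _ pp).1.
  move=> _ [D _ <-]; rewrite !gE ler_pM2r ?invr_gt0// lerD2r.
  rewrite -subr_le0 -sumrB.
  under eq_bigr do rewrite -sumrB.
  under eq_bigr do under eq_bigr do rewrite -mulrBr.
  exact: hV0.
(* Decoding [W'] by the identity gains exactly the squared norm of [q], divided by [N]. *)
apply: (@lt_le_trans _ _ (guess p W' (id_channel _ _))).
  rewrite !gE comp_id ltr_pM2r ?invr_gt0// ltrD2r -subr_gt0 -sumrB.
  under eq_bigr do rewrite -sumrB.
  under eq_bigr do under eq_bigr do rewrite -mulrBr -expr2.
  exact: sq.
by apply: ub_le_sup; [exact: (guess_has_sup _ pp).2|exists (id_channel _ _)].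
Qed.

End blackwell.

(** * Continuity and separation of the noisiness distance *)

Section noisiness_metric.
Variables (R : realType) (X : finType).

(** The error term is independent of [D] and [p], so it survives both suprema in
    [noisiness_dist]. *)
Lemma guess_dist_le (m : nat) (p : 'I_m * X -> R) (Y : finType)
    (W W' : DMC R X Y) D : prob_dist p ->
  guess p W D <= guess p W' D + \sum_x \sum_y `|tr W y x - tr W' y x|.
Proof.
move=> [p0 p1].
have {}p1 : \sum_u \sum_x p (u, x) = 1.
  by rewrite pair_bigA -p1; apply: eq_bigr => -[].
rewrite -lerBlDl -sumrB; set M := \sum_x _.
have M0 x : \sum_y `|tr W y x - tr W' y x| <= M.
  rewrite /M (bigD1 x)//= lerDl; do 2 (apply: sumr_ge0 => ? _).
  exact: normr_ge0.
rewrite -[leRHS]mul1r -p1 mulr_suml.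
apply: ler_sum => u _; rewrite -sumrB mulr_suml; apply: ler_sum => x _.
apply: (@le_trans _ _ (p (u, x) * \sum_y `|tr W y x - tr W' y x|)); last first.
  exact: ler_wpM2l.
rewrite -sumrB mulr_sumr; apply: ler_sum => y _.
rewrite -!mulrA -mulrBr -mulrBl ler_wpM2l//.
apply: le_trans (ler_norm _) _; rewrite normrM ler_piMr//.
by rewrite ger0_norm ?tr_ge0 ?tr_le1.
Qed.

Lemma Pc_dist_le (m : nat) (p : 'I_m.+1 * X -> R) (Y : finType)
    (W W' : DMC R X Y) : prob_dist p ->
  Pc p W <= Pc p W' + \sum_x \sum_y `|tr W y x - tr W' y x|.
Proof.
move=> pp; apply: ge_sup; first exact: (guess_has_sup _ pp).1.
move=> _ [D _ <-]; apply: (le_trans (guess_dist_le W W' D pp)).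
rewrite lerD2r; apply: ub_le_sup; first exact: (guess_has_sup _ pp).2.
by exists D.
Qed.

Lemma noisiness_dist_star_class_le (k : nat) (W W' : DMC R X 'I_k.+1) :
  noisiness_dist (star_class W) (star_class W') <=
  \sum_x \sum_y `|tr W y x - tr W' y x|.
Proof.
apply: noisiness_dist_le => [|m p pp].
  by do 2 (apply: sumr_ge0 => ? _).
rewrite !Pco_class// ler_distlC lerBlDr Pc_dist_le//=.
under eq_bigr do under eq_bigr do rewrite distrC.
by rewrite Pc_dist_le.
Qed.

Lemma continuous_noisiness_dist (k : nat) (c : DMCo_star R X) :
  continuous (fun W : DMC R X 'I_k.+1 => noisiness_dist c (star_class W)).
Proof.
move=> W0.
pose L (W : DMC R X 'I_k.+1) := \sum_x \sum_y `|tr W0 y x - tr W y x|.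
have L0 : L W0 = 0.
  by rewrite /L big1// => x _; rewrite big1// => y _; rewrite subrr normr0.
have cL : continuous L.
  apply: continuous_sum => x; apply: continuous_sum => y W.
  exact: (cvg_norm (cvgB (cvg_cst (tr W0 y x)) (@continuous_tr R X _ y x W))).
apply/(@cvgrPdist_lt _ _ _ (nbhs W0)) => e e0.
have /(@cvgrPdist_lt _ _ _ (nbhs W0))/(_ e e0) := cL W0.
apply: (@filterS _ (nbhs W0)) => W /=.
rewrite L0 sub0r normrN => LW; apply: le_lt_trans (le_lt_trans (ler_norm _) LW).
have := noisiness_dist_star_class_le W0 W; rewrite -/(L W) => h.
have := noisiness_dist_triangle (star_class W0) c (star_class W).
have := noisiness_dist_triangle (star_class W) c (star_class W0).
rewrite (noisiness_dist_sym (star_class W)) ler_distlC; lra.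
Qed.

(** At distance 0 all guessing probabilities agree, so [not_degraded_Pc] excludes failure of
    degradation in either direction. *)
Lemma noisiness_dist_eq0 (hX : (0 < #|X|)%N) (c c' : DMCo_star R X) :
  noisiness_dist c c' = 0 -> c = c'.
Proof.
have classE (d : DMCo_star R X) : d = star_class (projT2 (repr d)).
  by rewrite -[LHS]reprK /star_class; case: (repr d).
have deg (d d' : DMCo_star R X) : noisiness_dist d d' = 0 ->
    degraded (projT2 (repr d')) (projT2 (repr d)).
  move=> dd; apply: contrapT => /(not_degraded_Pc hX)[p pp].
  have := noisiness_dist_ub d d' pp.
  by rewrite dd normr_le0 subr_eq0 /Pco => /eqP ->; rewrite ltxx.
move=> cc; rewrite (classE c) (classE c'); apply/star_classP.
by split; apply: deg; rewrite // noisiness_dist_sym.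
Qed.

End noisiness_metric.

Theorem mainTheorem11 (R : realType) (X : finType) (hX : (0 < #|X|)%N) :
  natural_topology (@noisiness_topology R X).
Proof.
split.
  split; [exact: openT|exact: (@openI (noisiness_space R X))|].
  by move=> I F oF; apply: (@bigcup_open (noisiness_space R X)) => i _; exact: oF.
move=> k A Ak.
(* By definition of the quotient topology, openness is tested on channels. *)
have openE' (B : set (DMCo_star R X)) : open (@embed R X k @^-1` B) <->
    open [set W : DMC R X 'I_k.+1 | B (star_class W)].
  suff <- : \pi_(DMCo R X 'I_k.+1) @^-1` (@embed R X k @^-1` B) =
    [set W : DMC R X 'I_k.+1 | B (star_class W)] by [].
  by apply/seteqP; split=> W /=; rewrite embed_pi.
rewrite openE'; split=> [[U /noisiness_topologyP oU ->]|oA].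
  rewrite openE => W0 /= [/oU[e e0 eU] _].
  have := @continuous_noisiness_dist R X k (star_class W0) W0.
  move=> /(@cvgrPdist_lt _ _ _ (nbhs W0))/(_ e e0); rewrite noisiness_distxx.
  apply: (@filterS _ (nbhs W0)) => W /=; rewrite sub0r normrN => lte.
  split; last by exists W.
  by apply: eU; apply: le_lt_trans lte; exact: ler_norm.
(* The radius is the least distance from [c] to a channel whose class lies outside [A], or 1 if
   there is none. *)
have ballA c : A c -> exists2 e : R, 0 < e &
    forall c', DMCo_sub k c' -> noisiness_dist c c' < e -> A c'.
  move=> Ac; pose C := ~` [set W : DMC R X 'I_k.+1 | A (star_class W)].
  have [C0|/set0P Cn0] := eqVneq C set0.
    exists 1 => // _ [W <-] _; apply: contrapT => nA.
    by have : C W by []; rewrite C0.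
  have [W CW Wmin] := DMC_min (@continuous_noisiness_dist R X k c)
    (open_closedC oA) Cn0.
  exists (noisiness_dist c (star_class W)).
    rewrite lt_neqAle noisiness_dist_ge0 andbT; apply/eqP => /esym.
    by move=> /(noisiness_dist_eq0 hX) cW; apply: CW; rewrite /= -cW.
  move=> _ [W' <-]; rewrite ltNge => /negP h; apply: contrapT => CW'.
  by apply: h; exact: Wmin.
(* The balls are taken in the whole space, and only their traces on [DMCo_sub k] must lie in [A];
   their union is the required open [U]. *)
exists (\bigcup_(c in A) [set c' | exists2 e : R,
    (forall c'', DMCo_sub k c'' -> noisiness_dist c c'' < e -> A c'') &
    noisiness_dist c c' < e]).
  apply/noisiness_topologyP => c' [c Ac [e eA lte]].
  exists (e - noisiness_dist c c'); first by rewrite subr_gt0.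
  move=> c'' /= h; exists c => //; exists e => //.
  by apply: le_lt_trans (noisiness_dist_triangle c' _ _) _; rewrite -ltrBrDl.
apply/seteqP; split=> [c Ac|c [[d Ad [e eA lte]] ck]]; last exact: eA.
split; last exact: Ak.
by have [e e0 eA] := ballA c Ac; exists c => //; exists e; rewrite ?noisiness_distxx.
Qed.
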